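(* In the setting of the context, assume $Z:=\sum_{i=0}^N\mu_i<\infty$ and let $\lambda_1=\inf\{D(f):\mu(f)=0,\ \mu(f^2)=1\}$. Then $\kappa^{-1}/4\le\lambda_1\le\kappa^{-1}$, where $$\kappa^{-1}=\inf_{0\le n<m<N+1}\Big[\Big(\sum_{i=0}^n\mu_i\Big)^{-1}+\Big(\sum_{i=m}^N\mu_i\Big)^{-1}\Big]\Big(\sum_{j=n}^{m-1}\frac1{\mu_jb_j}\Big)^{-1}.$$ Furthermore, $\delta_L\wedge\delta_R\ge\kappa\ge Z^{-1}\delta_L$, where $$\delta_L=\sup_{1\le n<N+1}\sum_{i=1}^n\frac1{\mu_ia_i}\sum_{j=n}^N\mu_j,\qquad \delta_R=\sup_{0\le m<N}\sum_{j=0}^m\mu_j\sum_{k=m}^{N-1}\frac1{\mu_kb_k}.$$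
   Context: $E=\{i\in\mathbb Z:0\le i<N+1\}$, $1\le N\le\infty$; birth rates $b_i>0$ for $0\le i<N$ and $b_N=0$ if $N<\infty$; death rates $a_i>0$ for $1\le i\in E$, $a_0=0$. $\mu_0=1$, $\mu_n=\frac{b_0\cdots b_{n-1}}{a_1\cdots a_n}$; $\mu(f)=\sum_{i\in E}\mu_if_i$. $D(f)=\sum_{1\le i<N+1}\mu_ia_i(f_i-f_{i-1})^2$ with domain $\{f\in L^2(\mu):D(f)<\infty\}$. Convention $1/\infty=0$. *)

(* Defs.v *)
From mathcomp Require Import all_boot all_order all_algebra.
From mathcomp Require Import all_classical all_reals all_analysis.

Set Implicit Arguments.
Unset Strict Implicit.
Unset Printing Implicit Defensive.

Import Order.TTheory GRing.Theory Num.Theory.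

Local Open Scope classical_set_scope.
Local Open Scope ring_scope.
Local Open Scope ereal_scope.

(* The top state N ranges over {0, 1, ...} and infinity: [Some n] is the finite
   value n and [None] is infinity.  The state space E = {i | 0 <= i < N + 1} is
   [fun i => le_ext i N].  Rates and test functions are functions on nat of
   which only the values on E are ever used: every sum below is restricted to
   E, and a sum up to N - 1 to the indices i < N. *)
Definition le_ext (i : nat) (N : option nat) : bool :=
  if N is Some n then (i <= n)%N else true.

Definition lt_ext (i : nat) (N : option nat) : bool :=
  if N is Some n then (i < n)%N else true.

Definition bd_mu (R : realType) (a b : nat -> R) (n : nat) : R :=
  ((\prod_(0 <= i < n) b i) / (\prod_(1 <= i < n.+1) a i))%R.

(* mu(f), the sum being taken in increasing order of the states; for f in
   L^2(mu) with mu finite the series is absolutely convergent. *)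
Definition bd_int (R : realType) (N : option nat) (a b f : nat -> R) : \bar R :=
  \sum_(0 <= i <oo | le_ext i N) (bd_mu a b i * f i)%:E.

Definition bd_mass (R : realType) (N : option nat) (a b : nat -> R) : \bar R :=
  \sum_(0 <= i <oo | le_ext i N) (bd_mu a b i)%:E.

Definition bd_form (R : realType) (N : option nat) (a b f : nat -> R) : \bar R :=
  \sum_(1 <= i <oo | le_ext i N)
    (bd_mu a b i * a i * (f i - f i.-1) ^+ 2)%:E.

Definition bd_dom (R : realType) (N : option nat) (a b : nat -> R) :
    set (nat -> R) :=
  [set f | bd_int N a b (fun i => f i ^+ 2)%R < +oo /\ bd_form N a b f < +oo].

Definition bd_lambda1 (R : realType) (N : option nat) (a b : nat -> R) : \bar R :=
  ereal_inf [set bd_form N a b f | f in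
    [set f | [/\ bd_dom N a b f, bd_int N a b f = 0 &
                 bd_int N a b (fun i => f i ^+ 2)%R = 1]]].

Definition bd_kappa_inv (R : realType) (N : option nat) (a b : nat -> R) :
    \bar R :=
  ereal_inf [set x | exists n m : nat, [/\ (n < m)%N, le_ext m N &
    x = ((\sum_(0 <= i < n.+1) (bd_mu a b i)%:E)^-1
         + (\sum_(m <= i <oo | le_ext i N) (bd_mu a b i)%:E)^-1)
        * (\sum_(n <= j < m) ((bd_mu a b j * b j)^-1)%:E)^-1]].

(* The inverse on \bar R satisfies 0^-1 = +oo and +oo^-1 = 0, so that kappa lies
   in [0, +oo] and kappa^-1 is [bd_kappa_inv]. *)
Definition bd_kappa (R : realType) (N : option nat) (a b : nat -> R) : \bar R :=
  (bd_kappa_inv N a b)^-1.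

Definition bd_deltaL (R : realType) (N : option nat) (a b : nat -> R) : \bar R :=
  ereal_sup [set (\sum_(1 <= i < n.+1) ((bd_mu a b i * a i)^-1)%:E)
                 * (\sum_(n <= j <oo | le_ext j N) (bd_mu a b j)%:E)
            | n in [set n : nat | (1 <= n)%N /\ le_ext n N]].

Definition bd_deltaR (R : realType) (N : option nat) (a b : nat -> R) : \bar R :=
  ereal_sup [set (\sum_(0 <= j < m.+1) (bd_mu a b j)%:E)
                 * (\sum_(m <= k <oo | lt_ext k N) ((bd_mu a b k * b k)^-1)%:E)
            | m in [set m : nat | lt_ext m N]].

(* Main.v *)
(* Put the states on a line at the points x_i = sum_(j < i) 1/(mu_j b_j), so
   that D is the energy of the piecewise linear interpolation of f.
   Lower bound on lambda_1: with K = kappa and M, T the head and tail masses,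
   the definition of kappa says x_m - K/T(m) <= x_n + K/M(n) for all n < m, so
   some point t of the line separates these two families of numbers, i.e.
   T(m) (x_m - t) <= K and M(n) (t - x_n) <= K.  These are the Muckenhoupt
   conditions of the Hardy inequalities on the right and on the left of t, which
   bound the integral of (f - f(t))^2, hence the variance of f, by 4 K D(f).
   To avoid limits in the choice of t, this is done on {0, ..., p}, for which
   the condition is weaker, and p tends to infinity at the end.
   Upper bound: the test function is 0 up to n, 1 from m on, and linear in x in
   between. *)
Require Import Defs.
From mathcomp Require Import all_boot all_order all_algebra.
From mathcomp Require Import all_classical all_reals all_analysis.
From mathcomp Require Import ring lra zify.

Set Implicit Arguments.
Unset Strict Implicit.
Unset Printing Implicit Defensive.

Import Order.TTheory GRing.Theory Num.Theory.
Import numFieldNormedType.Exports.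

Local Open Scope classical_set_scope.
Local Open Scope ring_scope.

(** * Discrete Hardy inequalities *)

(** Cauchy-Schwarz by induction. The cross term obeys [2xy <= aB + Ab] because its square is at most
    [4abAB], and [(aB + Ab)^2 - 4abAB = (aB - Ab)^2]. *)
Lemma sqr_sum_le (R : realFieldType) (I : Type) (s : seq I) (d u v : I -> R) :
  (forall i, 0 <= u i) -> (forall i, 0 <= v i) ->
  (forall i, d i ^+ 2 <= u i * v i) ->
  (\sum_(i <- s) d i) ^+ 2 <= (\sum_(i <- s) u i) * (\sum_(i <- s) v i).
Proof.
move=> u0 v0 duv; elim: s => [|i s]; first by rewrite !big_nil expr0n mulr0.
rewrite !big_cons.
have : 0 <= \sum_(j <- s) u j by exact: sumr_ge0.
have : 0 <= \sum_(j <- s) v j by exact: sumr_ge0.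
move: (u0 i) (v0 i) (duv i).
move: (\sum_(j <- s) d j) (\sum_(j <- s) u j) (\sum_(j <- s) v j).
move: (d i) (u i) (v i) => {u0 v0 duv} x a b y A B a0 b0 xab B0 A0 yAB.
suff : (2 * x * y) <= a * B + A * b by nra.
have [xy0|xy0] := lerP (2 * x * y) 0; first by apply: le_trans xy0 _; nra.
rewrite -(@ler_pXn2r _ 2) ?nnegrE//; [|exact: ltW|by rewrite addr_ge0 ?mulr_ge0].
apply: (@le_trans _ _ (4 * (a * b) * (A * B))).
  rewrite (_ : (2 * x * y) ^+ 2 = 4 * (x ^+ 2) * y ^+ 2); last by ring.
  apply: ler_pM; rewrite ?sqr_ge0//; last by rewrite ler_pM2l.
  by rewrite mulr_ge0 ?sqr_ge0.
rewrite -subr_ge0 (_ : _ - _ = (a * B - A * b) ^+ 2) ?sqr_ge0//; ring.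
Qed.

(** With [S = sqrt (s + t)] one has [t = (S - sqrt s)(S + sqrt s)] and [S + sqrt s <= 2S]. *)
Lemma sqrt_increment_ge (R : rcfType) (s t : R) : 0 <= s -> 0 <= t ->
  t / Num.sqrt (s + t) <= 2 * (Num.sqrt (s + t) - Num.sqrt s).
Proof.
move=> s0 t0; have st0 : 0 <= s + t by exact: addr_ge0.
have le_st : Num.sqrt s <= Num.sqrt (s + t) by rewrite ler_wsqrtr// lerDl.
have [st_eq0|stN0] := eqVneq (Num.sqrt (s + t)) 0.
  by move: le_st; rewrite st_eq0 invr0 mulr0; lra.
rewrite ler_pdivrMr ?lt_neqAle ?sqrtr_ge0 1?eq_sym ?stN0//.
have := sqr_sqrtr st0; have := sqr_sqrtr s0; have := sqrtr_ge0 s.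
nra.
Qed.

(** Discrete form of the fact that [dU / sqrt U] integrates to [2 sqrt U]: by [sqrt_increment_ge]
    each term is at most an increment of the right-hand side. *)
Lemma sum_div_sqrt_head (R : rcfType) (u : nat -> R) n :
  (forall i, 0 <= u i) ->
  \sum_(0 <= j < n) u j / Num.sqrt (\sum_(0 <= l < j.+1) u l) <=
  2 * Num.sqrt (\sum_(0 <= l < n) u l).
Proof.
move=> u0; elim: n => [|n IHn]; first by rewrite !big_geq// mulr_ge0 ?sqrtr_ge0.
rewrite !big_nat_recr//=.
have s0 : 0 <= \sum_(0 <= l < n) u l by exact: sumr_ge0.
have := sqrt_increment_ge s0 (u0 n); lra.
Qed.

Lemma sum_div_sqrt_tail (R : rcfType) (u : nat -> R) m n :
  (forall i, 0 <= u i) ->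
  \sum_(m <= j < n) u j / Num.sqrt (\sum_(j <= l < n) u l) <=
  2 * Num.sqrt (\sum_(m <= l < n) u l).
Proof.
move=> u0; elim: {m}(n - m)%N {-2}m (erefl (n - m)%N) => [|k IHk] m mn.
  by rewrite !big_geq ?mulr_ge0 ?sqrtr_ge0// -subn_eq0 mn.
have ltmn : (m < n)%N by rewrite -subn_gt0 mn.
rewrite big_ltn// ![X in Num.sqrt X]big_ltn//.
have s0 : 0 <= \sum_(m.+1 <= l < n) u l by exact: sumr_ge0.
have {}IHk := IHk m.+1 ltac:(by rewrite subnS mn).
by have := sqrt_increment_ge s0 (u0 m); rewrite [_ + u m]addrC; lra.
Qed.

Lemma exchange_sum_triangle (V : nmodType) (F : nat -> nat -> V) n :
  \sum_(0 <= i < n) \sum_(0 <= j < i.+1) F i j =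
  \sum_(0 <= j < n) \sum_(j <= i < n) F i j.
Proof.
elim: n => [|n IHn]; first by rewrite !big_geq.
rewrite [LHS]big_nat_recr//= IHn.
transitivity (\sum_(0 <= j < n.+1) (\sum_(j <= i < n) F i j + F n j)); last first.
  by apply: eq_big_nat => j /andP[_ jn]; rewrite big_nat_recr.
by rewrite big_split/= [in RHS]big_nat_recr//= [X in _ + X + _]big_geq// addr0.
Qed.

(* Muckenhoupt's argument: Cauchy-Schwarz with the weights [sqrt (r_0 + ... + r_j)],
   then an exchange of the summations.  An edge has increment [d j], resistance
   [r j] and energy [e j]; asking for [d j ^+ 2 <= e j * r j] rather than
   [e j = d j ^+ 2 / r j] accommodates edges of resistance 0. *)
Lemma hardy_head (R : rcfType) (w r d e : nat -> R) (B : R) n :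
  (forall i, 0 <= w i) -> (forall i, 0 <= r i) -> (forall i, 0 <= e i) ->
  (forall i, d i ^+ 2 <= e i * r i) ->
  (forall i, (i < n)%N ->
    (\sum_(0 <= j < i.+1) r j) * (\sum_(i <= l < n) w l) <= B) ->
  \sum_(0 <= i < n) w i * (\sum_(0 <= j < i.+1) d j) ^+ 2 <=
  4 * B * \sum_(0 <= j < n) e j.
Proof.
move=> w0 r0 e0 der RWB.
case: n RWB => [|n] RWB; first by rewrite !big_geq// mulr0.
pose S i := Num.sqrt (\sum_(0 <= j < i.+1) r j).
pose V i := Num.sqrt (\sum_(i <= l < n.+1) w l).
have R0 i : 0 <= \sum_(0 <= j < i.+1) r j by exact: sumr_ge0.
have W0 i : 0 <= \sum_(i <= l < n.+1) w l by exact: sumr_ge0.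
have S0 i : 0 <= S i by exact: sqrtr_ge0.
have V0 i : 0 <= V i by exact: sqrtr_ge0.
have B0 : 0 <= B by apply: le_trans (RWB 0%N isT); rewrite mulr_ge0.
have SVB i : (i < n.+1)%N -> S i * V i <= Num.sqrt B.
  by move=> /RWB h; rewrite -sqrtrM// ler_wsqrtr.
(* Division by [S j] and [V i] gives 0 where these vanish; there the numerators [r j] and [w i]
   vanish too, so the bounds below survive. *)
have r_S0 i : S i = 0 -> r i = 0.
  move=> /eqP; rewrite sqrtr_eq0 => Sle0; apply/eqP; rewrite eq_le r0 andbT.
  by apply: le_trans Sle0; rewrite big_nat_recr//= lerDr sumr_ge0.
have w_V0 i : (i < n.+1)%N -> V i = 0 -> w i = 0.
  move=> ltin /eqP; rewrite sqrtr_eq0 => Vle0; apply/eqP; rewrite eq_le w0 andbT.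
  by apply: le_trans Vle0; rewrite big_ltn// lerDl sumr_ge0.
(* The bound [S i * V i <= sqrt B] trades the factor [S i] left by Cauchy-Schwarz for
   [sqrt B / V i]; what remains is a factor in [j] times a factor in [i]. *)
pose c i j := (2 * Num.sqrt B) * (e j * S j) * (w i / V i).
apply: (@le_trans _ _ (\sum_(0 <= i < n.+1) \sum_(0 <= j < i.+1) c i j)).
  apply: ler_sum_nat => i /andP[_ ltin]; rewrite /c -mulr_suml -mulr_sumr.
  have CS : (\sum_(0 <= j < i.+1) d j) ^+ 2 <=
            (\sum_(0 <= j < i.+1) e j * S j) * (2 * S i).
    apply: (@le_trans _ _ ((\sum_(0 <= j < i.+1) e j * S j) *
      (\sum_(0 <= j < i.+1) r j / S j))).
      apply: sqr_sum_le => j /=; rewrite ?mulr_ge0 ?invr_ge0//.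
      have [Sj0|Sj0] := eqVneq (S j) 0.
        by apply: (le_trans (der j)); rewrite (r_S0 _ Sj0) Sj0 !mul0r !mulr0.
      apply: (le_trans (der j)).
      by rewrite mulrACA mulfV// mulr1.
    by rewrite ler_wpM2l ?sumr_ge0// => [j _|]; rewrite ?mulr_ge0// sum_div_sqrt_head.
  apply: (le_trans (ler_wpM2l (w0 i) CS)).
  have wSV : w i * S i <= Num.sqrt B * (w i / V i).
    have [Vi0|Vi0] := eqVneq (V i) 0; first by rewrite (w_V0 _ ltin Vi0) !mul0r mulr0.
    rewrite mulrCA ler_wpM2l// ler_pdivlMr ?SVB// lt_neqAle eq_sym Vi0 V0//.
  have : 0 <= \sum_(0 <= j < i.+1) e j * S j.
    by apply: sumr_ge0 => j _; rewrite mulr_ge0.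
  by move: (\sum_(_ <= _ < _) _) (w i / V i) wSV => E q; nra.
(* The sum of [w i / V i] over [i >= j] is at most [2 * V j], and [S j * V j <= sqrt B] once more:
   the constant is [2 sqrt B * 2 * sqrt B = 4B]. *)
rewrite exchange_sum_triangle [leRHS]mulr_sumr; apply: ler_sum_nat => j /andP[_ ltjn].
rewrite /c -mulr_sumr.
have T := sum_div_sqrt_tail j n.+1 w0; rewrite -/(V _) in T.
apply: (le_trans (ler_wpM2l _ T)); first by rewrite !mulr_ge0 ?sqrtr_ge0.
have sB := sqr_sqrtr B0; have sB0 := sqrtr_ge0 B.
apply: (@le_trans _ _ ((4 * Num.sqrt B * e j) * (S j * V j))).
  by rewrite -/(V j); lra.
apply: (le_trans (ler_wpM2l _ (SVB _ ltjn))); first by rewrite !mulr_ge0.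
rewrite -{3}sB; lra.
Qed.

(** The reflection sending [i] to [n - i.+1] exchanges heads and tails and reduces this to
    [hardy_head]. *)
Lemma hardy_tail (R : rcfType) (w r d e : nat -> R) (B : R) n :
  (forall i, 0 <= w i) -> (forall i, 0 <= r i) -> (forall i, 0 <= e i) ->
  (forall i, d i ^+ 2 <= e i * r i) ->
  (forall i, (i < n)%N ->
    (\sum_(i <= j < n) r j) * (\sum_(0 <= l < i.+1) w l) <= B) ->
  \sum_(0 <= i < n) w i * (\sum_(i <= j < n) d j) ^+ 2 <=
  4 * B * \sum_(0 <= j < n) e j.
Proof.
move=> w0 r0 e0 der RWB.
have rev (F : nat -> R) i : (i < n)%N ->
    \sum_(n - i.+1 <= j < n) F j = \sum_(0 <= j < i.+1) F (n - j.+1)%N.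
  move=> ltin; rewrite -{1}[(n - _)%N]add0n big_addn subKn// [RHS]big_nat_rev/=.
  by apply: eq_big_nat => j /andP[_ ltji]; congr F; lia.
have rev0 (F : nat -> R) i : (i < n)%N ->
    \sum_(0 <= j < (n - i.+1).+1) F j = \sum_(i <= j < n) F (n - j.+1)%N.
  move=> ltin; have -> : \sum_(i <= j < n) F (n - j.+1)%N =
      \sum_(n - (n - i.+1).+1 <= j < n) F (n - j.+1)%N.
    by congr (\sum_(_ <= j < n) _); lia.
  by rewrite rev; [apply: eq_big_nat => j jn; congr F; lia|lia].
pose op (F : nat -> R) i := F (n - i.+1)%N.
rewrite big_nat_rev [X in _ <= _ * X]big_nat_rev/=.
rewrite (@eq_big_nat _ _ _ 0 n _
   (fun i => op w i * (\sum_(0 <= j < i.+1) op d j) ^+ 2)); last first.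
  by move=> i /andP[_ ltin]; rewrite !add0n rev.
apply: (@hardy_head _ (op w) (op r) (op d) (op e)) => [i|i|i|i|i ltin];
  do ?[exact: w0|exact: r0|exact: e0|exact: der].
rewrite -rev// -rev0//; apply: RWB; lia.
Qed.

(** * Poincaré inequality on a finite weighted path *)

Lemma sum_nat_diff (V : zmodType) (F : nat -> V) m n : (m <= n)%N ->
  \sum_(m <= i < n) F i = \sum_(0 <= i < n) F i - \sum_(0 <= i < m) F i.
Proof.
by move=> lemn; rewrite [\sum_(0 <= i < n) _](@big_cat_nat _ _ _ m)//= addrAC subrr add0r.
Qed.

Lemma poincare_finite (R : rcfType) (w r f : nat -> R) (K : R) p :
  (forall i, 0 < w i) -> (forall i, 0 < r i) -> 0 <= K ->
  (forall n m, (n < m <= p)%N -> \sum_(n <= j < m) r j <=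
     K * ((\sum_(0 <= i < n.+1) w i)^-1 + (\sum_(m <= i < p.+1) w i)^-1)) ->
  exists c, \sum_(0 <= i < p.+1) w i * (f i - c) ^+ 2 <=
    4 * K * \sum_(0 <= j < p) (f j.+1 - f j) ^+ 2 / r j.
Proof.
move=> w_gt0 r_gt0 K0 rK.
have w_ge0 i : 0 <= w i by exact: ltW.
pose M n := \sum_(0 <= i < n.+1) w i.
pose T m := \sum_(m <= i < p.+1) w i.
pose x i := \sum_(0 <= j < i) r j.
have x0 : x 0%N = 0 by rewrite /x big_geq.
have xS i : x i.+1 = x i + r i by rewrite /x big_nat_recr.
have x_le i j : (i <= j)%N -> x i <= x j.
  by move=> leij; rewrite -subr_ge0 -sum_nat_diff// sumr_ge0// => k _; exact: ltW.
have M_gt0 n : 0 < M n.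
  by rewrite /M big_nat_recr//= ltr_wpDl// sumr_ge0.
have T_gt0 m : (m <= p)%N -> 0 < T m.
  by move=> lemp; rewrite /T big_nat_recr//= ltr_wpDl// sumr_ge0.
pose F (m : 'I_p.+1) := x m - K / T m.
(* The separating point is the largest number of the lower family; starting the maximum at 0 keeps
   it in the segment from [x 0 = 0] to [x p]. *)
pose t := \big[Order.max/0]_(m < p.+1) F m.
have t_ge0 : 0 <= t by exact: bigmax_ge_id.
have t_le n : (n <= p)%N -> t <= x n + K / M n.
  move=> lenp; have xn0 : 0 <= x n by rewrite -x0 x_le.
  have KM0 : 0 <= K / M n by rewrite divr_ge0// ltW.
  apply: bigmax_le => [|m _]; first by rewrite addr_ge0.
  have lemp : (m <= p)%N by rewrite -ltnS.
  have KT0 : 0 <= K / T m by rewrite divr_ge0// ltW// T_gt0.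
  rewrite /F; have [lemn|ltnm] := leqP m n; first by have := x_le _ _ lemn; lra.
  have := rK n m; rewrite ltnm lemp => /(_ isT).
  rewrite sum_nat_diff 1?ltnW// -/(x _) -/(x _) -/(M _) -/(T _) mulrDr; lra.
have t_ge m : (m <= p)%N -> x m - K / T m <= t.
  by rewrite -ltnS => ltmp; exact: (le_bigmax _ F (Ordinal ltmp)).
have t_lexp : t <= x p.
  apply: bigmax_le => [|m _]; first by rewrite -x0 x_le.
  have lemp : (m <= p)%N by rewrite -ltnS.
  have KT0 : 0 <= K / T m by rewrite divr_ge0// ltW// T_gt0.
  by have := x_le _ _ lemp; rewrite /F; lra.
(* The edge [j, j + 1] is cut at t into a right part rR and a left part rL. *)
pose rR j := Num.max (x j.+1) t - Num.max (x j) t.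
pose rL j := Num.min (x j.+1) t - Num.min (x j) t.
have r0 j : 0 <= r j by exact: ltW.
have rR0 j : 0 <= rR j.
  by rewrite /rR xS; have := r0 j; case: (leP (x j + r j)); case: (leP (x j)); lra.
have rL0 j : 0 <= rL j.
  by rewrite /rL xS; have := r0 j; case: (leP (x j + r j)); case: (leP (x j)); lra.
have rRL j : rR j + rL j = r j.
  by rewrite /rR /rL xS; have := r0 j; case: (leP (x j + r j)); case: (leP (x j)); lra.
have sumR i : \sum_(0 <= j < i) rR j = Num.max (x i) t - t.
  by rewrite telescope_sumr// x0 [Num.max 0 t]max_r.
have sumL i : (i <= p)%N -> \sum_(i <= j < p) rL j = t - Num.min (x i) t.
  by move=> leip; rewrite telescope_sumr// min_r.
(* [D] is the slope of the piecewise linear interpolation of [f]. [A i] is its integral from [t] to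
   [x i] when [x i] lies to the right of [t], [C i] that from [x i] to [t] when it lies to the left,
   and [f 0 + C 0] is the interpolated value at [t]. *)
pose D j := (f j.+1 - f j) / r j.
pose A i := \sum_(0 <= j < i) D j * rR j.
pose C i := \sum_(i <= j < p) D j * rL j.
have fAC i : (i <= p)%N -> f i - (f 0%N + C 0%N) = A i - C i.
  move=> leip; rewrite -[f i](subrK (f 0%N)) -(telescope_sumr f)//.
  rewrite /A /C (@big_cat_nat _ _ _ i 0 p)//=.
  rewrite (@eq_big_nat _ _ _ 0 i _ (fun j => D j * rR j + D j * rL j)).
    by rewrite big_split/=; ring.
  by move=> j _; rewrite -mulrDr rRL divfK// gt_eqF.
(* One of the two integrals is always empty, so [(A i - C i)^2] has no cross term. *)
have AC0 i : (i <= p)%N -> A i * C i = 0.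
  move=> leip; have [lext|/ltW letx] := lerP (x i) t.
    rewrite /A big_nat_cond big1 ?mul0r// => j; rewrite andbT => /andP[_ ltji].
    by rewrite /rR !max_r ?subrr ?mulr0// (le_trans _ lext)// x_le// ltnW.
  rewrite /C big_nat_cond big1 ?mulr0// => j; rewrite andbT => /andP[leij _].
  by rewrite /rL !min_r ?subrr ?mulr0// (le_trans letx)// x_le// ltnW.
exists (f 0%N + C 0%N).
(* Edge [j] ends at vertex [j.+1], hence the shifted weights; vertex 0 is lost harmlessly since
   [A 0 = 0]. The Hardy condition is [t_ge] to the right of [t], and to the left the resistance is
   0. *)
have HR : \sum_(0 <= i < p) w i.+1 * A i.+1 ^+ 2 <=
    4 * K * \sum_(0 <= j < p) D j ^+ 2 * rR j.
  apply: (@hardy_head _ (fun i => w i.+1) rR) => // [i|i|i ltip].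
  - by rewrite mulr_ge0// sqr_ge0.
  - by rewrite exprMn -mulrA -expr2.
  rewrite sumR (_ : \sum_(i <= l < p) w l.+1 = T i.+1); last first.
    by rewrite /T big_add1.
  have := t_ge _ ltip; have := T_gt0 _ ltip => Ti0.
  rewrite lerBlDr -lerBlDl ler_pdivlMr//.
  by case: (leP (x i.+1) t) => // _ _; rewrite subrr mul0r.
have HL : \sum_(0 <= i < p) w i * C i ^+ 2 <=
    4 * K * \sum_(0 <= j < p) D j ^+ 2 * rL j.
  apply: (@hardy_tail _ w rL) => // [i|i|i ltip].
  - by rewrite mulr_ge0// sqr_ge0.
  - by rewrite exprMn -mulrA -expr2.
  rewrite sumL 1?ltnW// -/(M _).
  have := t_le _ (ltnW ltip); rewrite -lerBlDl ler_pdivlMr ?M_gt0//.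
  by case: (leP (x i) t) => // _ _; rewrite subrr mul0r.
apply: (@le_trans _ _ (\sum_(0 <= i < p.+1) (w i * A i ^+ 2 + w i * C i ^+ 2))).
  apply: ler_sum_nat => i /andP[_]; rewrite ltnS => leip.
  by rewrite fAC// -mulrDr ler_wpM2l// sqrrB AC0// mul0rn subr0.
rewrite big_split/= big_nat_recl//= [X in _ + X]big_nat_recr//=.
rewrite {1}/A [C p]big_geq// [X in X ^+ 2]big_geq// expr0n/= !mulr0 add0r addr0.
(* As [rR + rL = r], the energies of the two parts add up to that of the whole edges, so the
   constant stays [4 * K]. *)
apply: (le_trans (lerD HR HL)); rewrite -mulrDr -big_split/=.
rewrite le_eqVlt; apply/orP; left; apply/eqP; congr (_ * _).
apply: eq_bigr => j _; rewrite -mulrDr rRL /D.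
by rewrite expr_div_n [r j ^+ 2]expr2 invfM mulrA divfK// gt_eqF.
Qed.

(** * Filtered series of extended reals as limits of real series *)

Local Open Scope ereal_scope.

(** Extension by zero turns a series restricted to the state space into a plain real series, to
    which limit theorems apply. *)
Definition zero_off (R : realType) (P : pred nat) (u : nat -> R) : nat -> R :=
  fun i => (if P i then u i else 0)%R.

(** The terms may have any sign, as is needed for [mu(f)]: the extended series is the limit of its
    partial sums, and these are real. *)
Lemma eseries_EFin (R : realType) (P : pred nat) (u : nat -> R) (l : R) :
  series (zero_off P u) @ \oo --> l ->
  \sum_(0 <= i <oo | P i) (u i)%:E = l%:E.
Proof.
move=> ul; apply/cvg_lim => //.
rewrite (_ : (fun n => _) = EFin \o series (zero_off P u)).
  by apply: cvg_comp ul _; exact: cvg_id.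
apply/funext => n /=; rewrite seriesEnat/= -sumEFin big_mkcond/=.
by apply: eq_bigr => i _; rewrite /zero_off; case: ifP.
Qed.

Lemma nneseries_is_cvg (R : realType) (P : pred nat) (u : nat -> R) :
  (forall i, P i -> (0 <= u i)%R) ->
  \sum_(0 <= i <oo | P i) (u i)%:E < +oo -> cvgn (series (zero_off P u)).
Proof.
move=> u0 ufin; apply: nnseries_is_cvg.
  by move=> i; rewrite /zero_off; case: ifP => // /u0.
rewrite eseries_mkcond in ufin; apply: le_lt_trans ufin.
rewrite le_eqVlt; apply/orP; left; apply/eqP/eq_eseriesr => i _.
by rewrite /zero_off; case: ifP.
Qed.

Lemma le_ext_trans (N : option nat) i j : (i <= j)%N -> le_ext j N -> le_ext i N.
Proof. by case: N => //= n; exact: leq_trans. Qed.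

Lemma lt_extS (N : option nat) i : lt_ext i N = le_ext i.+1 N.
Proof. by case: N. Qed.

Lemma big_le_ext (V : Type) (idx : V) (op : Monoid.law idx) (N : option nat)
    (F : nat -> V) m p : le_ext p N ->
  \big[op/idx]_(m <= i < p.+1 | le_ext i N) F i = \big[op/idx]_(m <= i < p.+1) F i.
Proof.
move=> pN; rewrite big_nat_cond [RHS]big_nat_cond; apply: eq_bigl => i.
case: (boolP (m <= i < p.+1)%N) => //= /andP[_]; rewrite ltnS => leip.
exact: le_ext_trans pN.
Qed.

(** * Masses, resistances and kappa as real numbers *)

Definition bd_rates (R : realType) (N : option nat) (a b : nat -> R) : Prop :=
  [/\ le_ext 1 N, forall i, lt_ext i N -> (0 < b i)%R,
      forall i, (1 <= i)%N -> le_ext i N -> (0 < a i)%R &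
      bd_mass N a b < +oo].

Lemma bd_mu_gt0 (R : realType) (N : option nat) (a b : nat -> R) i :
  bd_rates N a b -> le_ext i N -> (0 < bd_mu a b i)%R.
Proof.
move=> [_ b0 a0 _] iN; rewrite /bd_mu divr_gt0//.
  rewrite big_nat; apply: prodr_gt0 => j /andP[_ ltji].
  by rewrite b0// lt_extS; exact: le_ext_trans iN.
rewrite big_nat; apply: prodr_gt0 => j /andP[lt0j ltji].
by rewrite a0//; exact: le_ext_trans iN.
Qed.

(** Detailed balance: both sides are the conductance of the edge from [i] to [i.+1]. It translates
    [D] and [deltaL], written with [a], into the resistances, written with [b]. *)
Lemma bd_mu_balance (R : realType) (N : option nat) (a b : nat -> R) i :
  bd_rates N a b -> le_ext i.+1 N ->
  (bd_mu a b i.+1 * a i.+1 = bd_mu a b i * b i)%R.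
Proof.
move=> [_ _ a0 _] iN; rewrite /bd_mu big_nat_recr//= [X in (_ / X * _)%R]big_nat_recr//=.
have ai0 : a i.+1 != 0%R by rewrite gt_eqF// a0.
by rewrite invfM !mulrA divfK// mulrAC.
Qed.

Lemma bd_resistance_gt0 (R : realType) (N : option nat) (a b : nat -> R) i :
  bd_rates N a b -> lt_ext i N -> (0 < (bd_mu a b i * b i)^-1)%R.
Proof.
move=> rates iN; rewrite invr_gt0 mulr_gt0//; last by case: rates => _ + _ _; exact.
by apply: (bd_mu_gt0 rates); apply: le_ext_trans (leqnSn i) _; rewrite -lt_extS.
Qed.

Lemma bd_mu0 (R : realType) (a b : nat -> R) : bd_mu a b 0 = 1%R.
Proof. by rewrite /bd_mu !big_geq// divr1. Qed.

Definition bd_head (R : realType) (a b : nat -> R) (n : nat) : R :=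
  (\sum_(0 <= i < n.+1) bd_mu a b i)%R.

(** [fine] loses nothing here, since the total mass is finite ([bd_tailE]). *)
Definition bd_tail (R : realType) (N : option nat) (a b : nat -> R) (m : nat) : R :=
  fine (\sum_(m <= i <oo | le_ext i N) (bd_mu a b i)%:E).

Definition bd_resistance (R : realType) (a b : nat -> R) (n m : nat) : R :=
  (\sum_(n <= j < m) (bd_mu a b j * b j)^-1)%R.

Definition bd_ratio (R : realType) (N : option nat) (a b : nat -> R) (n m : nat) : R :=
  (((bd_head a b n)^-1 + (bd_tail N a b m)^-1) / bd_resistance a b n m)%R.

Lemma bd_mass_split (R : realType) (N : option nat) (a b : nat -> R) m :
  bd_rates N a b ->
  bd_mass N a b = \sum_(0 <= i < m | le_ext i N) (bd_mu a b i)%:E +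
    \sum_(m <= i <oo | le_ext i N) (bd_mu a b i)%:E.
Proof.
move=> rates; rewrite /bd_mass (nneseries_split_cond 0%N m)// => i iN.
by rewrite lee_fin ltW// (bd_mu_gt0 rates).
Qed.

Lemma bd_tailE (R : realType) (N : option nat) (a b : nat -> R) m :
  bd_rates N a b ->
  \sum_(m <= i <oo | le_ext i N) (bd_mu a b i)%:E = (bd_tail N a b m)%:E.
Proof.
move=> rates; rewrite fineK// ge0_fin_numE; last first.
  by apply: nneseries_ge0 => i _ iN; rewrite lee_fin ltW// (bd_mu_gt0 rates).
have := bd_mass_split m rates; case: (rates) => _ _ _ fin E.
apply: le_lt_trans fin; rewrite E leeDr// sume_ge0// => i iN.
by rewrite lee_fin ltW// (bd_mu_gt0 rates).
Qed.

Lemma bd_massE (R : realType) (N : option nat) (a b : nat -> R) :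
  bd_rates N a b -> bd_mass N a b = (bd_tail N a b 0)%:E.
Proof. exact: bd_tailE. Qed.

Lemma sum_mu_le_tail (R : realType) (N : option nat) (a b : nat -> R) m p :
  bd_rates N a b -> le_ext p N ->
  (\sum_(m <= i < p.+1) bd_mu a b i <= bd_tail N a b m)%R.
Proof.
move=> rates pN; rewrite -lee_fin -bd_tailE// -sumEFin -(big_le_ext _ _ _ pN).
apply: nneseries_lim_ge => i _ iN.
by rewrite lee_fin ltW// (bd_mu_gt0 rates).
Qed.

Lemma bd_tail_gt0 (R : realType) (N : option nat) (a b : nat -> R) m :
  bd_rates N a b -> le_ext m N -> (0 < bd_tail N a b m)%R.
Proof.
move=> rates mN; apply: lt_le_trans (sum_mu_le_tail _ rates mN).
by rewrite big_nat1 (bd_mu_gt0 rates).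
Qed.

Lemma bd_head_gt0 (R : realType) (N : option nat) (a b : nat -> R) n :
  bd_rates N a b -> le_ext n N -> (0 < bd_head a b n)%R.
Proof.
move=> rates nN; rewrite /bd_head big_nat_recr//= ltr_wpDl ?(bd_mu_gt0 rates)//.
rewrite big_nat sumr_ge0// => i /andP[_ ltin].
by rewrite ltW// (bd_mu_gt0 rates)//; exact: le_ext_trans (ltnW ltin) nN.
Qed.

Lemma bd_tail0_split (R : realType) (N : option nat) (a b : nat -> R) m :
  bd_rates N a b -> le_ext m.+1 N ->
  (bd_tail N a b 0 = bd_head a b m + bd_tail N a b m.+1)%R.
Proof.
move=> rates mN; apply: EFin_inj; rewrite EFinD -!bd_tailE// /bd_head -sumEFin.
rewrite -(big_le_ext _ _ _ (le_ext_trans (leqnSn m) mN)).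
exact: (bd_mass_split m.+1 rates).
Qed.

Lemma bd_resistance_sum_gt0 (R : realType) (N : option nat) (a b : nat -> R) n m :
  bd_rates N a b -> (n < m)%N -> le_ext m N -> (0 < bd_resistance a b n m)%R.
Proof.
move=> rates ltnm mN.
rewrite /bd_resistance big_ltn// ltr_pwDl//.
  by apply: (bd_resistance_gt0 rates); rewrite lt_extS; exact: le_ext_trans mN.
rewrite big_nat sumr_ge0// => j /andP[_ ltjm]; rewrite ltW//.
by apply: (bd_resistance_gt0 rates); rewrite lt_extS; exact: le_ext_trans mN.
Qed.

Lemma bd_ratio_gt0 (R : realType) (N : option nat) (a b : nat -> R) n m :
  bd_rates N a b -> (n < m)%N -> le_ext m N -> (0 < bd_ratio N a b n m)%R.
Proof.
move=> rates ltnm mN; have nN := le_ext_trans (ltnW ltnm) mN.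
rewrite divr_gt0 ?(bd_resistance_sum_gt0 rates)// addr_gt0// invr_gt0.
  exact: bd_head_gt0 nN.
exact: bd_tail_gt0.
Qed.

Lemma bd_kappa_invE (R : realType) (N : option nat) (a b : nat -> R) :
  bd_rates N a b ->
  bd_kappa_inv N a b = ereal_inf [set x | exists n m : nat,
    [/\ (n < m)%N, le_ext m N & x = (bd_ratio N a b n m)%:E]].
Proof.
move=> rates; congr ereal_inf; apply/funext => x; apply/propext.
suff E n m : (n < m)%N -> le_ext m N ->
    ((\sum_(0 <= i < n.+1) (bd_mu a b i)%:E)^-1
     + (\sum_(m <= i <oo | le_ext i N) (bd_mu a b i)%:E)^-1)
    * (\sum_(n <= j < m) ((bd_mu a b j * b j)^-1)%:E)^-1 =
    (bd_ratio N a b n m)%:E.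
  by split=> -[n [m [ltnm mN ->]]]; exists n, m; rewrite E.
move=> ltnm mN; have nN := le_ext_trans (ltnW ltnm) mN.
rewrite bd_tailE// !sumEFin !inver -/(bd_head a b n) -/(bd_resistance a b n m).
rewrite !gt_eqF ?(bd_head_gt0 rates)// ?(bd_tail_gt0 rates)//.
exact: bd_resistance_sum_gt0 mN.
Qed.

(** The infimum is finite because the pair [(0, 1)] is admissible when [N >= 1]. It may be 0, in
    which case kappa is [+oo]. *)
Lemma bd_kappa_inv_fin (R : realType) (N : option nat) (a b : nat -> R) :
  bd_rates N a b ->
  exists k : R, [/\ bd_kappa_inv N a b = k%:E, (0 <= k)%R &
    forall n m, (n < m)%N -> le_ext m N -> (k <= bd_ratio N a b n m)%R].
Proof.
move=> rates; have [N1 _ _ _] := rates.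
have le_ratio n m : (n < m)%N -> le_ext m N ->
    bd_kappa_inv N a b <= (bd_ratio N a b n m)%:E.
  by move=> ltnm mN; rewrite bd_kappa_invE//; apply: ereal_inf_lbound; exists n, m.
have k0 : 0 <= bd_kappa_inv N a b.
  rewrite bd_kappa_invE//; apply/ereal_infP => _ [n [m [ltnm mN ->]]].
  by rewrite lee_fin ltW// bd_ratio_gt0.
have kfin : bd_kappa_inv N a b \is a fin_num.
  by rewrite ge0_fin_numE//; apply: le_lt_trans (le_ratio 0%N 1%N isT N1) (ltry _).
exists (fine (bd_kappa_inv N a b)); split; first by rewrite fineK.
  by rewrite -lee_fin fineK.
by move=> n m ltnm mN; rewrite -lee_fin fineK// le_ratio.
Qed.

(** * Comparison of kappa with deltaL and deltaR *)

(** Inversion reverses the order of the nonnegative extended reals, so kappa is the supremum of the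
    inverse ratios. *)
Lemma bd_kappa_le (R : realType) (N : option nat) (a b : nat -> R) (d : \bar R) :
  bd_rates N a b -> 0 <= d ->
  (forall n m, (n < m)%N -> le_ext m N -> ((bd_ratio N a b n m)^-1)%:E <= d) ->
  bd_kappa N a b <= d.
Proof.
move=> rates d0 le_d; have [k [kE k0 _]] := bd_kappa_inv_fin rates.
rewrite /bd_kappa inve_ple ?inE//; last by rewrite kE lee_fin.
rewrite bd_kappa_invE//; apply/ereal_infP => _ [n [m [ltnm mN ->]]].
have q0 := bd_ratio_gt0 rates ltnm mN.
rewrite inve_ple ?inE// ?inver ?gt_eqF//; last by rewrite lee_fin ltW.
exact: le_d.
Qed.

(** The parallel combination of the head and tail masses, [(M^-1 + T^-1)^-1], is at most each of
    them. *)
Lemma bd_ratio_inv (R : realType) (N : option nat) (a b : nat -> R) n m :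
  bd_rates N a b -> (n < m)%N -> le_ext m N ->
  ((bd_ratio N a b n m)^-1 <= bd_resistance a b n m * bd_tail N a b m)%R /\
  ((bd_ratio N a b n m)^-1 <= bd_head a b n * bd_resistance a b n m)%R.
Proof.
move=> rates ltnm mN; have nN := le_ext_trans (ltnW ltnm) mN.
have S0 := bd_resistance_sum_gt0 rates ltnm mN.
have M0 := bd_head_gt0 rates nN; have T0 := bd_tail_gt0 rates mN.
have invD (x y : R) : (0 < x -> 0 < y -> (x^-1 + y^-1)^-1 <= x)%R.
  move=> x0 y0; rewrite -[leRHS]invrK lef_pV2 ?posrE ?addr_gt0 ?invr_gt0//.
  by rewrite lerDl invr_ge0 ltW.
rewrite /bd_ratio invf_div; split; first by rewrite ler_pM2l// addrC invD.
by rewrite mulrC ler_pM2r// invD.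
Qed.

Lemma bd_deltaL_elem (R : realType) (N : option nat) (a b : nat -> R) n :
  bd_rates N a b -> le_ext n N ->
  (\sum_(1 <= i < n.+1) ((bd_mu a b i * a i)^-1)%:E) *
    (\sum_(n <= j <oo | le_ext j N) (bd_mu a b j)%:E) =
  (bd_resistance a b 0 n * bd_tail N a b n)%:E.
Proof.
move=> rates nN; rewrite bd_tailE// sumEFin -EFinM; congr ((_ * _)%:E).
rewrite big_add1; apply: eq_big_nat => j /andP[_ ltjn].
by rewrite (bd_mu_balance rates)//; exact: le_ext_trans nN.
Qed.

(** Keep the tail mass in [bd_ratio_inv] and enlarge the resistance by starting it at 0. *)
Lemma bd_kappa_le_deltaL (R : realType) (N : option nat) (a b : nat -> R) :
  bd_rates N a b -> bd_kappa N a b <= bd_deltaL N a b.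
Proof.
move=> rates; have [N1 _ _ _] := rates.
have ub n : (1 <= n)%N -> le_ext n N ->
    (bd_resistance a b 0 n * bd_tail N a b n)%:E <= bd_deltaL N a b.
  move=> n1 nN; apply: ereal_sup_ubound; exists n => //.
  exact: bd_deltaL_elem.
apply: bd_kappa_le => // [|n m ltnm mN].
  apply: le_trans (ub _ (leqnn 1) N1); rewrite lee_fin ltW// mulr_gt0//.
    exact: bd_resistance_sum_gt0 N1.
  exact: bd_tail_gt0.
apply: le_trans (ub m _ mN); last by case: m ltnm {mN}.
have [le _] := bd_ratio_inv rates ltnm mN.
rewrite lee_fin; apply: (le_trans le); rewrite ler_pM2r ?(bd_tail_gt0 rates)//.
rewrite /bd_resistance (sum_nat_diff _ (ltnW ltnm)) gerBl.
rewrite big_nat sumr_ge0// => j /andP[_ ltjn]; rewrite ltW//.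
apply: (bd_resistance_gt0 rates); rewrite lt_extS; apply: le_ext_trans mN.
exact: ltn_trans ltnm.
Qed.

(** Keep the head mass in [bd_ratio_inv] and enlarge the resistance by running it to the top
    state. *)
Lemma bd_kappa_le_deltaR (R : realType) (N : option nat) (a b : nat -> R) :
  bd_rates N a b -> bd_kappa N a b <= bd_deltaR N a b.
Proof.
move=> rates; have [N1 _ _ _] := rates.
have ub n m : (n < m)%N -> le_ext m N ->
    (bd_head a b n * bd_resistance a b n m)%:E <= bd_deltaR N a b.
  move=> ltnm mN; have nN := le_ext_trans (ltnW ltnm) mN.
  apply: (@le_trans _ _ ((\sum_(0 <= j < n.+1) (bd_mu a b j)%:E) *
      (\sum_(n <= k <oo | lt_ext k N) ((bd_mu a b k * b k)^-1)%:E))); last first.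
    apply: ereal_sup_ubound; exists n => //.
    by rewrite /= lt_extS; exact: le_ext_trans mN.
  rewrite sumEFin EFinM; apply: lee_wpmul2l.
    by rewrite lee_fin ltW// (bd_head_gt0 rates).
  rewrite /bd_resistance -sumEFin.
  have -> : \sum_(n <= j < m) ((bd_mu a b j * b j)^-1)%:E =
      \sum_(n <= j < m | lt_ext j N) ((bd_mu a b j * b j)^-1)%:E.
    rewrite big_nat_cond [RHS]big_nat_cond; apply: eq_bigl => j.
    case: (boolP (n <= j < m)%N) => //= /andP[_ ltjm].
    by rewrite lt_extS (le_ext_trans ltjm).
  apply: nneseries_lim_ge => j _ jN; rewrite lee_fin ltW//.
  exact: (bd_resistance_gt0 rates).
apply: bd_kappa_le => // [|n m ltnm mN].
  apply: le_trans (ub 0%N 1%N isT N1); rewrite lee_fin ltW// mulr_gt0//.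
    by apply: (bd_head_gt0 rates); case: (N).
  exact: bd_resistance_sum_gt0 N1.
apply: le_trans (ub n m ltnm mN).
by have [_ le] := bd_ratio_inv rates ltnm mN; rewrite lee_fin.
Qed.

(** Take the pair [(0, n)] in kappa: the head mass is [mu_0 = 1], so the inverse ratio is
    [S * T / (1 + T)], and [1 + T <= Z] because [n >= 1]. *)
Lemma bd_deltaL_le_kappa (R : realType) (N : option nat) (a b : nat -> R) :
  bd_rates N a b -> (bd_mass N a b)^-1 * bd_deltaL N a b <= bd_kappa N a b.
Proof.
move=> rates; have [k [kE k0 k_le]] := bd_kappa_inv_fin rates.
have N0 : le_ext 0 N by case: (N).
have z0 := bd_tail_gt0 rates N0.
rewrite bd_massE// inver gt_eqF// lee_pdivrMl//.
apply/ereal_supP => _ [n [n1 nN] <-]; rewrite bd_deltaL_elem//.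
rewrite -lee_pdivrMl// -EFinM /bd_kappa kE.
have S0 := bd_resistance_sum_gt0 rates n1 nN; have T0 := bd_tail_gt0 rates nN.
set q := (_^-1 * _)%R; have q0 : (0 < q)%R by rewrite !mulr_gt0// invr_gt0.
rewrite inve_pge ?inE ?lee_fin//; last exact: ltW.
rewrite inver gt_eqF// lee_fin; apply: (le_trans (k_le 0%N n n1 nN)).
have z1T : (1 + bd_tail N a b n <= bd_tail N a b 0)%R.
  case: n n1 nN {S0 q q0} T0 => // n _ nN T0; rewrite (bd_tail0_split rates nN) lerD2r.
  rewrite /bd_head big_ltn// bd_mu0 lerDl big_nat sumr_ge0// => i /andP[_ ltin].
  by rewrite ltW// (bd_mu_gt0 rates)//; exact: le_ext_trans (ltnW ltin) nN.
rewrite /bd_ratio /bd_head big_nat1 bd_mu0 invr1 /q invfM invrK invfM mulrCA mulrC.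
rewrite ler_pM2l ?invr_gt0//.
by rewrite ler_pdivlMr// mulrDl mul1r mulVf ?gt_eqF// addrC.
Qed.

(** * Lower bound on lambda_1 *)

(** The last state is [p = min(n, N)]. It is chosen before [u], so that one truncation serves the
    series of [f] and of [f^2] together. *)
Lemma series_zero_off (R : realType) (N : option nat) n :
  exists2 p, le_ext p N & forall u : nat -> R,
    series (zero_off (le_ext^~ N) u) n.+1 = (\sum_(0 <= i < p.+1) u i)%R.
Proof.
have E (q p : nat) (u : nat -> R) : (p <= q)%N -> le_ext p N ->
    (forall i, (p < i)%N -> (i <= q)%N -> ~~ le_ext i N) ->
    series (zero_off (le_ext^~ N) u) q.+1 = (\sum_(0 <= i < p.+1) u i)%R.
  move=> lepq pN qN; rewrite seriesEnat/= (@big_cat_nat _ _ _ p.+1)//=.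
  rewrite [X in (_ + X)%R]big_nat_cond [X in (_ + X)%R]big1 ?addr0.
    apply: eq_big_nat => i /andP[_]; rewrite ltnS => leip.
    by rewrite /zero_off (le_ext_trans leip pN).
  move=> i; rewrite andbT ltnS => /andP[ltpi leiq].
  by rewrite /zero_off (negbTE (qN i ltpi leiq)).
case: N E => [N|] E; last by exists n => // u; apply: E => // i; lia.
have [lenN|ltNn] := leqP n N; first by exists n => // u; apply: E => // i; lia.
exists N => [|u]; first exact: leqnn.
by apply: E; [exact: ltnW|exact: leqnn|move=> i ltNi _ /=; lia].
Qed.

(** [mu] has mass at least [mu_0 = 1] on the truncation, so subtracting the undivided square of the
    mean gives a lower bound on the second moment about any [c]. Nothing is lost in the limit, where
    [mu(f) = 0]. *)
Lemma variance_le_form (R : realType) (N : option nat) (a b f : nat -> R) (k d : R) p :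
  bd_rates N a b -> (0 < k)%R ->
  (forall n m, (n < m)%N -> le_ext m N -> (k <= bd_ratio N a b n m)%R) ->
  bd_form N a b f = d%:E -> le_ext p N ->
  (\sum_(0 <= i < p.+1) bd_mu a b i * f i ^+ 2 -
   (\sum_(0 <= i < p.+1) bd_mu a b i * f i) ^+ 2 <= 4 * k^-1 * d)%R.
Proof.
move=> rates k0 k_le fd pN.
have mu0 i : le_ext i N -> (0 < bd_mu a b i)%R by exact: bd_mu_gt0.
have leN i : (i < p.+1)%N -> le_ext i N by rewrite ltnS => /le_ext_trans; exact.
(* [poincare_finite] wants positive weights and resistances at every index, hence the value 1 off
   the state space. *)
pose w i := if le_ext i N then bd_mu a b i else 1%R.
pose r j := if lt_ext j N then ((bd_mu a b j * b j)^-1)%R else 1%R.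
have w_gt0 i : (0 < w i)%R by rewrite /w; case: ifP => // /mu0.
have r_gt0 i : (0 < r i)%R.
  by rewrite /r; case: ifP => // iN; exact: (bd_resistance_gt0 rates).
have wE i : (i < p.+1)%N -> w i = bd_mu a b i by move=> /leN iN; rewrite /w iN.
have rk n m : (n < m <= p)%N -> (\sum_(n <= j < m) r j <=
    k^-1 * ((\sum_(0 <= i < n.+1) w i)^-1 + (\sum_(m <= i < p.+1) w i)^-1))%R.
  move=> /andP[ltnm lemp]; have mN := le_ext_trans lemp pN.
  rewrite (_ : (\sum_(n <= j < m) r j)%R = bd_resistance a b n m); last first.
    apply: eq_big_nat => j /andP[_ ltjm].
    by rewrite /r lt_extS (le_ext_trans ltjm mN).
  rewrite (_ : (\sum_(0 <= i < n.+1) w i)%R = bd_head a b n); last first.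
    by apply: eq_big_nat => i /andP[_ ltin]; apply: wE; lia.
  rewrite (_ : (\sum_(m <= i < p.+1) w i = \sum_(m <= i < p.+1) bd_mu a b i)%R);
    last first.
    by apply: eq_big_nat => i /andP[_ ltip]; exact: wE.
  have S0 := bd_resistance_sum_gt0 rates ltnm mN.
  have := k_le n m ltnm mN; rewrite /bd_ratio ler_pdivlMr// mulrC -ler_pdivlMr//.
  move=> /le_trans; apply; rewrite mulrC ler_pM2l ?invr_gt0// lerD2l.
  have Tp0 : (0 < \sum_(m <= i < p.+1) bd_mu a b i)%R.
    rewrite big_nat_recr//= ltr_wpDl ?mu0// big_nat sumr_ge0// => i /andP[_ ltip].
    by rewrite ltW// mu0// leN// ltnW.
  (* Truncating the tail at [p] decreases it and so weakens the condition. *)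
  by rewrite lef_pV2 ?posrE ?(bd_tail_gt0 rates)// sum_mu_le_tail.
have kV0 : (0 <= k^-1)%R by rewrite invr_ge0 ltW.
have [c] := poincare_finite f w_gt0 r_gt0 kV0 rk.
have -> : (\sum_(0 <= j < p) (f j.+1 - f j) ^+ 2 / r j =
    \sum_(1 <= i < p.+1) bd_mu a b i * a i * (f i - f i.-1) ^+ 2)%R.
  rewrite big_add1; apply: eq_big_nat => j /andP[_ ltjp].
  have jN : le_ext j.+1 N by rewrite leN.
  by rewrite (bd_mu_balance rates)// /r lt_extS jN invrK mulrC.
have form_le : (\sum_(1 <= i < p.+1) bd_mu a b i * a i * (f i - f i.-1) ^+ 2 <= d)%R.
  rewrite -lee_fin -fd -sumEFin -(big_le_ext _ _ _ pN).
  apply: nneseries_lim_ge => i i1 iN.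
  have a0 : (0 < a i)%R by case: rates => _ _ + _; exact.
  rewrite lee_fin mulr_ge0 ?sqr_ge0//.
  by rewrite mulr_ge0 ?(ltW a0) ?(ltW (mu0 _ iN)).
have expand : (\sum_(0 <= i < p.+1) w i * (f i - c) ^+ 2 =
    \sum_(0 <= i < p.+1) bd_mu a b i * f i ^+ 2 -
    2 * c * (\sum_(0 <= i < p.+1) bd_mu a b i * f i) +
    c ^+ 2 * bd_head a b p)%R.
  rewrite /bd_head !mulr_sumr -sumrN -!big_split/=.
  by apply: eq_big_nat => i /andP[_ ltip]; rewrite wE//; ring.
have head1 : (1 <= bd_head a b p)%R.
  rewrite /bd_head big_ltn// bd_mu0 lerDl big_nat sumr_ge0// => i /andP[_ ltip].
  by rewrite ltW// mu0// leN.
rewrite expand.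
set S1 := (\sum_(0 <= i < p.+1) bd_mu a b i * f i)%R.
set S2 := (\sum_(0 <= i < p.+1) bd_mu a b i * f i ^+ 2)%R => le.
have le4 := ler_wpM2l (mulr_ge0 (ler0n R 4) kV0) form_le.
apply: le_trans le4; apply: le_trans le.
have : (0 <= c ^+ 2 * (bd_head a b p - 1))%R by rewrite mulr_ge0 ?sqr_ge0 ?subr_ge0.
have := sqr_ge0 (c - S1)%R; nra.
Qed.

Lemma kappa_inv_le_lambda1 (R : realType) (N : option nat) (a b : nat -> R) :
  bd_rates N a b -> bd_kappa_inv N a b / 4%:E <= bd_lambda1 N a b.
Proof.
move=> rates; have [k [kE k0 k_le]] := bd_kappa_inv_fin rates.
have mu0 i : le_ext i N -> (0 <= bd_mu a b i)%R by move=> /(bd_mu_gt0 rates)/ltW.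
have a0 i : (1 <= i)%N -> le_ext i N -> (0 <= a i)%R.
  by case: rates => _ _ a0 _ i1 iN; exact/ltW/a0.
apply/ereal_infP => _ [f [[f2fin Dfin] f0 f1] <-].
have D0 : 0 <= bd_form N a b f.
  apply: nneseries_ge0 => i i1 iN.
  by rewrite lee_fin mulr_ge0 ?sqr_ge0// mulr_ge0 ?mu0 ?a0.
rewrite kE inver gt_eqF// -EFinM.
(* For [k = 0] the claim is only [D(f) >= 0]. *)
have [->|kN0] := eqVneq k 0%R; first by rewrite mul0r.
have {kN0} k_gt0 : (0 < k)%R by rewrite lt_neqAle eq_sym kN0.
have /fineK DE : bd_form N a b f \is a fin_num by rewrite ge0_fin_numE.
set d := fine _ in DE; rewrite -DE lee_fin.
pose E := le_ext^~ N.
have c0 : cvgn (series (zero_off E (bd_mu a b))).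
  by apply: nneseries_is_cvg => //; case: rates.
have c2 : cvgn (series (zero_off E (fun i => bd_mu a b i * f i ^+ 2)%R)).
  by apply: nneseries_is_cvg => // i iN; rewrite mulr_ge0 ?mu0 ?sqr_ge0.
(* Absolute convergence comes from [|f| <= 1 + f^2] and the finiteness of [mu(1)] and [mu(f^2)]. *)
have c1 : cvgn (series (zero_off E (fun i => bd_mu a b i * f i)%R)).
  apply: normed_cvg; apply: (series_le_cvg _ _ _ (is_cvg_seriesD c0 c2)) => i //=.
    rewrite addrfctE /zero_off /E /=; case: (le_ext i N) (mu0 i) => [/(_ isT) mui|_].
      by rewrite addr_ge0// mulr_ge0// sqr_ge0.
    by rewrite addr0.
  rewrite addrfctE /zero_off /E /=; case: (le_ext i N) (mu0 i) => [/(_ isT) mui|_];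
    last first.
    by rewrite normr0 addr0.
  have le1 : (`|f i| <= 1 + f i ^+ 2)%R.
    by rewrite -(real_normK (num_real (f i))); have := normr_ge0 (f i); nra.
  by have := ler_wpM2l mui le1; rewrite normrM (ger0_norm mui) mulrDr mulr1.
have l2 : limn (series (zero_off E (fun i => bd_mu a b i * f i ^+ 2)%R)) = 1%R.
  by apply: EFin_inj; rewrite -(eseries_EFin c2); exact: f1.
have l1 : limn (series (zero_off E (fun i => bd_mu a b i * f i)%R)) = 0%R.
  by apply: EFin_inj; rewrite -(eseries_EFin c1); exact: f0.
(* The truncated variances tend to [mu(f^2) - mu(f)^2 = 1], while their bound does not depend on the
   truncation. *)
have cV : (series (zero_off E (fun i => bd_mu a b i * f i ^+ 2)) n -
    series (zero_off E (fun i => bd_mu a b i * f i)) n ^+ 2)%R @[n --> \oo] -->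
    (1 - 0 ^+ 2 : R)%R.
  by rewrite -l2 -l1; apply: cvgB => //; apply: cvgM.
suff : (1 - 0 ^+ 2 <= 4 * k^-1 * d)%R.
  rewrite expr0n/= subr0 mulrAC ler_pdivlMr// mul1r => kd.
  by rewrite ler_pdivrMr// mulrC.
apply: (ler_cvg_to cV (cvg_cst _)); near=> n.
have n_gt0 : (0 < n)%N by near: n; exact: nbhs_infty_gt.
have [p pN E1] := series_zero_off R N n.-1.
by rewrite -(prednK n_gt0) !E1; exact: variance_le_form pN.
Unshelve. all: by end_near. Qed.

(** * Upper bound on lambda_1 *)

(** The states strictly between [n] and [m] are dropped from the integral, which leaves those where
    [g] is 0 or 1. *)
Lemma variance_ge (R : realType) (N : option nat) (a b g : nat -> R) (c V : R) n m :
  bd_rates N a b -> (n < m)%N -> le_ext m N ->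
  (forall i, (i <= n)%N -> g i = 0%R) -> (forall i, (m <= i)%N -> g i = 1%R) ->
  bd_int N a b (fun i => (g i - c) ^+ 2)%R = V%:E ->
  (bd_head a b n * c ^+ 2 + bd_tail N a b m * (1 - c) ^+ 2 <= V)%R.
Proof.
move=> rates ltnm mN g0 g1 VE.
have mu0 i : le_ext i N -> (0 <= bd_mu a b i)%R by move=> /(bd_mu_gt0 rates)/ltW.
have t0 i : le_ext i N -> 0 <= (bd_mu a b i * (g i - c) ^+ 2)%:E.
  by move=> iN; rewrite lee_fin mulr_ge0 ?sqr_ge0 ?mu0.
rewrite -lee_fin -VE /bd_int (nneseries_split_cond 0%N m)// add0n EFinD leeD//.
  case: m ltnm mN {g1} => // m; rewrite ltnS => lenm mN.
  rewrite big_le_ext ?(le_ext_trans (leqnSn m))// sumEFin lee_fin.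
  rewrite (@big_cat_nat _ _ _ n.+1)//= /bd_head mulr_suml.
  rewrite -[leLHS]addr0 lerD//.
    rewrite le_eqVlt; apply/orP; left; apply/eqP/eq_big_nat => i /andP[_ ltin].
    by rewrite g0// sub0r sqrrN.
  rewrite big_nat sumr_ge0// => i /andP[_ ltim].
  by rewrite mulr_ge0 ?sqr_ge0 ?mu0//; exact: le_ext_trans (ltnW ltim) mN.
rewrite EFinM muleC -bd_tailE// -nneseriesZl; last first.
  by move=> i /mu0; rewrite lee_fin.
rewrite eseries_cond [leRHS]eseries_cond le_eqVlt; apply/orP; left; apply/eqP.
by apply: eq_eseriesr => i /andP[_ lemi]; rewrite g1// -EFinM mulrC.
Qed.

(** Only the edges between [n] and [m] carry an increment, [s * r_j / S] with [r_j] the resistance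
    of the edge; its energy is [s^2 r_j / S^2], and the [r_j] add up to [S]. *)
Lemma form_ramp (R : realType) (N : option nat) (a b : nat -> R) (c s : R) n m :
  bd_rates N a b -> (n < m)%N -> le_ext m N ->
  bd_form N a b
    (fun i => s * (bd_resistance a b n (minn i m) / bd_resistance a b n m - c))%R =
  (s ^+ 2 / bd_resistance a b n m)%:E.
Proof.
move=> rates ltnm mN; set S := bd_resistance a b n m.
have S0 : (0 < S)%R := bd_resistance_sum_gt0 rates ltnm mN.
rewrite /bd_form (nneseries_split_cond 1%N m); last first.
  move=> i iN; rewrite lee_fin; case: i iN => [_|i iN].
    by rewrite subrr expr0n mulr0.
  rewrite mulr_ge0 ?sqr_ge0// mulr_ge0 ?(ltW (bd_mu_gt0 rates iN))//.
  by case: rates => _ _ a0 _; rewrite ltW// a0.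
rewrite [X in _ + X]eseries0 ?adde0; last first.
  move=> i ltmi iN; rewrite (minn_idPr (ltnW ltmi)) (minn_idPr _); last lia.
  by rewrite subrr expr0n mulr0.
rewrite add1n big_le_ext// sumEFin; congr (_%:E).
rewrite big_add1/= (big_cat_nat (leq0n n) (ltnW ltnm))/=.
rewrite [X in (X + _)%R]big_nat [X in (X + _)%R]big1 ?add0r.
  transitivity (\sum_(n <= j < m) s ^+ 2 / S ^+ 2 * (bd_mu a b j * b j)^-1)%R.
    apply: eq_big_nat => j /andP[lenj ltjm].
    have jN : le_ext j.+1 N := le_ext_trans ltjm mN.
    have q0 : (bd_mu a b j * b j != 0)%R.
      by rewrite -invr_eq0 gt_eqF// (bd_resistance_gt0 rates)// lt_extS.
    rewrite (minn_idPl ltjm) (minn_idPl (ltnW ltjm)) (bd_mu_balance rates)//.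
    have -> : bd_resistance a b n j.+1 =
        (bd_resistance a b n j + (bd_mu a b j * b j)^-1)%R.
      by rewrite /bd_resistance big_nat_recr.
    by move: (bd_mu a b j * b j)%R q0 => q q0; field; rewrite q0 gt_eqF.
  by rewrite -mulr_sumr -/(bd_resistance a b n m) -/S expr2; field; rewrite gt_eqF.
move=> j ltjn; rewrite /bd_resistance !big_geq ?subrr ?expr0n ?mulr0//; lia.
Qed.

Lemma lambda1_le_ratio (R : realType) (N : option nat) (a b : nat -> R) n m :
  bd_rates N a b -> (n < m)%N -> le_ext m N ->
  bd_lambda1 N a b <= (bd_ratio N a b n m)%:E.
Proof.
move=> rates ltnm mN; have nN := le_ext_trans (ltnW ltnm) mN.
have mu0 i : le_ext i N -> (0 <= bd_mu a b i)%R by move=> /(bd_mu_gt0 rates)/ltW.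
set S := bd_resistance a b n m.
have S0 : (0 < S)%R := bd_resistance_sum_gt0 rates ltnm mN.
pose g i := (bd_resistance a b n (minn i m) / S)%R.
have g0 i : (i <= n)%N -> g i = 0%R.
  by move=> lein; rewrite /g /bd_resistance big_geq ?mul0r//; lia.
have g1 i : (m <= i)%N -> g i = 1%R.
  by move=> lemi; rewrite /g (minn_idPr lemi) mulfV// gt_eqF.
have r_ge0 j : (j < m)%N -> (0 <= (bd_mu a b j * b j)^-1)%R.
  by move=> ltjm; rewrite ltW// (bd_resistance_gt0 rates)// lt_extS (le_ext_trans ltjm).
have g01 i : (0 <= g i <= 1)%R.
  have [lein|ltni] := leqP i n; first by rewrite g0// lexx ler01.
  have [lemi|ltim] := leqP m i; first by rewrite g1// lexx ler01.
  rewrite /g (minn_idPl (ltnW ltim)); apply/andP; split.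
    rewrite divr_ge0 ?(ltW S0)// /bd_resistance big_nat sumr_ge0// => j /andP[_ ltji].
    by apply: r_ge0; exact: ltn_trans ltim.
  rewrite ler_pdivrMr// mul1r /S /bd_resistance.
  rewrite [leRHS](big_cat_nat (ltnW ltni) (ltnW ltim))/= lerDl.
  by rewrite big_nat sumr_ge0// => j /andP[_ /r_ge0].
pose E i := le_ext i N.
have cmu : cvgn (series (zero_off E (bd_mu a b))).
  by apply: nneseries_is_cvg => //; case: rates.
(* Bounded functions are integrable, the mass being finite. *)
have cbound (h : nat -> R) (B : R) : (forall i, 0 <= h i <= B)%R ->
    cvgn (series (zero_off E (fun i => bd_mu a b i * h i)%R)).
  move=> hB; have B0 : (0 <= B)%R by have /andP[] := hB 0%N; exact: le_trans.
  have c : cvgn (series (B *: zero_off E (bd_mu a b))%R) by exact: is_cvg_seriesZ.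
  apply: (series_le_cvg _ _ _ c) => i; rewrite ?scalrfctE /zero_off /E;
    have /andP[hi0 hiB] := hB i; case: (le_ext i N) (mu0 i) => [/(_ isT) mui|_] //=.
  - by rewrite mulr_ge0.
  - by rewrite mulr_ge0.
  - by rewrite scaler0.
  - by rewrite mulrC; exact: ler_wpM2r.
  - by rewrite scaler0.
have cG := cbound g 1%R g01.
set G := limn _ in cG; set z := limn _ in cmu.
have zE : z = bd_tail N a b 0.
  by apply: EFin_inj; rewrite -bd_massE// -(eseries_EFin cmu).
have z0 : (0 < z)%R by rewrite zE (bd_tail_gt0 rates)//; case: (N).
(* The mean of [g], so that [g - c] is centred. *)
pose c := (G / z)%R.
have cV : cvgn (series (zero_off E (fun i => bd_mu a b i * (g i - c) ^+ 2)%R)).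
  apply: (cbound _ ((1 + `|c|) ^+ 2)%R) => i; rewrite sqr_ge0/=.
  rewrite -(real_normK (num_real (g i - c)%R)) ler_pXn2r ?nnegrE ?addr_ge0//.
  have /andP[gi0 gi1] := g01 i.
  by apply: (le_trans (ler_normB _ _)); rewrite lerD2r ger0_norm.
set V := limn _ in cV.
have VE : bd_int N a b (fun i => (g i - c) ^+ 2)%R = V%:E.
  exact: eseries_EFin cV.
have := variance_ge rates ltnm mN g0 g1 VE.
have M0 := bd_head_gt0 rates nN; have T0 := bd_tail_gt0 rates mN.
set M := bd_head a b n in M0 *; set T := bd_tail N a b m in T0 * => leV.
(* The least value of [M c^2 + T (1 - c)^2] over [c] is [MT / (M + T)]: multiplied by [M + T], the
   difference of the two is the square of [M c - T (1 - c)]. *)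
have VMT : (1 <= V * (M^-1 + T^-1))%R.
  have -> : (M^-1 + T^-1 = (M + T) / (M * T))%R.
    by field; rewrite !gt_eqF.
  rewrite mulrA ler_pdivlMr ?mulr_gt0// mul1r.
  have := sqr_ge0 (M * c - T * (1 - c))%R; nra.
have V0 : (0 < V)%R.
  have : (0 < M^-1 + T^-1)%R by rewrite addr_gt0 ?invr_gt0.
  by move=> MT0; rewrite -(pmulr_lgt0 _ MT0); exact: lt_le_trans VMT.
pose s := (Num.sqrt V)^-1%R.
have s2 : (s ^+ 2 = V^-1)%R by rewrite /s exprVn sqr_sqrtr// ltW.
pose f i := (s * (g i - c))%R.
have fform : bd_form N a b f = (V^-1 / S)%:E by rewrite -s2; exact: form_ramp.
have f2 : bd_int N a b (fun i => f i ^+ 2)%R = 1.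
  apply: eseries_EFin.
  rewrite (_ : series _ = fun k => (V^-1 *
      series (zero_off E (fun i => bd_mu a b i * (g i - c) ^+ 2)) k)%R).
    by rewrite -(mulVf (lt0r_neq0 V0)); apply: cvgM => //; exact: cvg_cst.
  apply/funext => k; rewrite !seriesEnat/= mulr_sumr; apply: eq_bigr => i _.
  by rewrite /zero_off /E; case: ifP => _; rewrite ?mulr0// /f exprMn s2 mulrCA.
have f1 : bd_int N a b f = 0.
  apply: eseries_EFin.
  rewrite (_ : series _ = fun k =>
      (s * (series (zero_off E (fun i => bd_mu a b i * g i)) k -
            c * series (zero_off E (bd_mu a b)) k))%R).
    have -> : (0 = s * (G - c * z))%R.
      by rewrite /c divfK ?gt_eqF// subrr mulr0.
    apply: cvgM; first exact: cvg_cst.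
    by apply: cvgB => //; apply: cvgM => //; exact: cvg_cst.
  apply/funext => k; rewrite !seriesEnat/= mulr_sumr -sumrB mulr_sumr.
  apply: eq_bigr => i _.
  by rewrite /zero_off /E; case: ifP => _; rewrite /f/=; ring.
apply: (@le_trans _ _ (bd_form N a b f)).
  apply: ereal_inf_lbound; exists f => //; split=> //.
  by split; rewrite ?f2 ?fform ltry.
rewrite fform lee_fin /bd_ratio ler_pM2r ?invr_gt0//.
by rewrite -div1r ler_pdivrMr// mulrC.
Qed.

Theorem corollary6p6 (R : realType) (N : option nat) (a b : nat -> R)
  (N_ge1 : le_ext 1 N)
  (b_gt0 : forall i : nat, lt_ext i N -> (0 < b i)%R)
  (b_top : forall n : nat, N = Some n -> b n = 0%R)
  (a_gt0 : forall i : nat, (1 <= i)%N -> le_ext i N -> (0 < a i)%R)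
  (a_bot : a 0%N = 0%R)
  (Z_fin : bd_mass N a b < +oo) :
  [/\ (bd_kappa N a b)^-1 / 4%:E <= bd_lambda1 N a b,
      bd_lambda1 N a b <= (bd_kappa N a b)^-1,
      bd_kappa N a b <= Order.min (bd_deltaL N a b) (bd_deltaR N a b) &
      (bd_mass N a b)^-1 * bd_deltaL N a b <= bd_kappa N a b].
Proof.
have rates : bd_rates N a b by [].
rewrite {1 2}/bd_kappa inveK; split.
- exact: kappa_inv_le_lambda1.
- rewrite bd_kappa_invE//; apply/ereal_infP => _ [n [m [ltnm mN ->]]].
  exact: lambda1_le_ratio.
- by rewrite le_min bd_kappa_le_deltaL ?bd_kappa_le_deltaR.
- exact: bd_deltaL_le_kappa.
Qed.
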